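(* Let $E$ be an (LF)-space. Then $(E,w)$ is linearly Eberlein-Grothendieck if and only if $E$ is normable.
   Context: All topological spaces are assumed to be Tychonoff (in particular locally convex spaces are Hausdorff) and all vector spaces are over $\mathbb{R}$. A Fréchet space is a completely metrizable locally convex space. An (LF)-space is a locally convex space that is the locally convex inductive limit of a countable inductive system of Fréchet spaces (i.e. $E=\bigcup_n E_n$ for an increasing sequence of Fréchet spaces $E_n$ with continuous inclusions $E_n\to E_{n+1}$, and $E$ carries the finest locally convex topology making all inclusions $E_n\to E$ continuous; the limit is not assumed strict). For a locally convex space $E$, $(E,w)$ denotes $E$ with its weak topology $w=\sigma(E,E^{\ast})$, where $E^{\ast}$ is the space of continuous linear functionals on $E$. $C_p(K)$ is the space of continuous real-valued functions on $K$ with the topology of pointwise convergence. A locally convex space $H$ is linearly Eberlein-Grothendieck if $H$ is linearly isomorphic (i.e. linearly homeomorphic) to a linear subspace of $C_p(K)$ for some compact space $K$. *)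

(* Defs.v *)
From HB Require Import structures.
From mathcomp Require Import all_boot all_order all_algebra.
From mathcomp Require Import all_classical all_reals all_analysis.

Set Implicit Arguments.
Unset Strict Implicit.
Unset Printing Implicit Defensive.

Import Order.TTheory GRing.Theory Num.Theory.
Import numFieldNormedType.Exports.

Local Open Scope classical_set_scope.
Local Open Scope ring_scope.

Definition homeomorphism (T U : topologicalType) (f : T -> U) : Prop :=
  continuous f /\
  exists g : U -> T, [/\ cancel f g, cancel g f & continuous g].

(* The range of a linear map is a linear subspace, so this says that [f] is a
   linear homeomorphism of [E] onto a linear subspace of [F]. *)
Definition linear_embedding (R : realType) (E F : preTopologicalLmodType R)
    (f : {linear E -> F}) : Prop :=
  continuous f /\
  exists g : F -> E, cancel f g /\ {within range f, continuous g}.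

(* The uniformity carried by a [tvsType] need not be the translation-invariant
   one, so completeness is expressed through a compatible metric only. *)
Definition completely_metrizable (R : realType) (T : topologicalType) : Prop :=
  exists (M : metricType R) (f : T -> M), homeomorphism f /\
    forall F : set_system M, ProperFilter F -> cauchy F -> exists x : M, F --> x.

Definition is_frechet (R : realType) (E : tvsType R) : Prop :=
  completely_metrizable R E.

Definition normable (R : realType) (E : tvsType R) : Prop :=
  exists (V : normedModType R) (f : {linear E -> V}), homeomorphism f.

(* The topology of [E] makes every [i n] continuous and is the finest locally
   convex topology doing so.  A competing locally convex topology on the vector
   space [E] is given as a tvs [F] with a linear bijection [f : E -> F]. *)
Definition is_lc_inductive_topology (R : realType) (E : tvsType R)
    (S : nat -> tvsType R) (i : forall n, {linear S n -> E}) : Prop :=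
  (forall n, continuous (i n)) /\
  forall (F : tvsType R) (f : {linear E -> F}), bijective f ->
    (forall n, continuous (f \o i n)) -> continuous f.

(* The steps [S n] are identified with subspaces of [E] through the injections
   [i n]; [j n] is the inclusion of [S n] into [S n.+1]. *)
Definition is_LF (R : realType) (E : tvsType R) : Prop :=
  hausdorff_space E /\
  exists (S : nat -> tvsType R) (i : forall n, {linear S n -> E})
         (j : forall n, {linear S n -> S n.+1}),
    [/\ forall n, is_frechet (S n),
        forall n, injective (i n),
        forall n, continuous (j n) /\ i n.+1 \o j n =1 i n,
        \bigcup_n range (i n) = [set: E]
      & is_lc_inductive_topology i].

Definition dual (R : realType) (E : tvsType R) : Type :=
  {phi : {linear E -> R^o} | continuous phi}.

HB.instance Definition _ (R : realType) (E : tvsType R) :=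
  gen_eqMixin (dual E).
HB.instance Definition _ (R : realType) (E : tvsType R) :=
  gen_choiceMixin (dual E).

Definition weak_space (R : realType) (E : tvsType R) : Type := E.

Section WeakSpace.
Variables (R : realType) (E : tvsType R).

Definition dual_eval (x : E) : {ptws dual E -> R^o} := fun phi => sval phi x.

HB.instance Definition _ := GRing.Lmodule.copy (weak_space E) E.
HB.instance Definition _ :=
  Topological.copy (weak_space E) (initial_topology dual_eval).

End WeakSpace.

Section Cp.
Variables (R : realType) (K : topologicalType).

Definition continuous_pred : {pred (K -> R^o)} :=
  fun f => `[< continuous f >].

Lemma continuous_pred_submod : submod_closed continuous_pred.
Proof.
split; first by apply/asboolP => x; exact: cvg_cst.
move=> a f g /asboolP cf /asboolP cg; apply/asboolP => x.
by apply: cvgD; [apply: cvgZr; exact: cf|exact: cg].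
Qed.

HB.instance Definition _ :=
  GRing.isSubmodClosed.Build R (K -> R^o) continuous_pred
    continuous_pred_submod.

Record Cp : Type := MkCp {
  Cp_fun :> K -> R^o ;
  Cp_funP : Cp_fun \in continuous_pred }.

HB.instance Definition _ := [isSub for Cp_fun].
HB.instance Definition _ := [Choice of Cp by <:].
HB.instance Definition _ := [SubChoice_isSubLmodule of Cp by <:].

HB.instance Definition _ := Topological.copy Cp
  (initial_topology (Cp_fun : Cp -> {ptws K -> R^o})).

End Cp.

Definition linearly_Eberlein_Grothendieck (R : realType)
    (H : preTopologicalLmodType R) : Prop :=
  exists K : topologicalType, [/\ compact [set: K], hausdorff_space K
    & exists f : {linear H -> Cp R K}, linear_embedding f].

(* Main.v *)
Require Import Defs.
From HB Require Import structures.
From mathcomp Require Import all_boot all_order all_algebra.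
From mathcomp Require Import all_classical all_reals all_analysis.
From mathcomp Require Import ring lra.

(** Suppose that [f] embeds [(E, w)] in [C_p(K)]. Compactness of [K] makes the
    sup norm [p x] of [f x] finite, and [p] is a norm because [f] is injective.
    It is the supremum of continuous functions, so its sublevel sets are closed.
    On a Frechet space a seminorm with closed sublevel sets is continuous
    ([barrelled_seminorm], from Baire's theorem), so [p] is continuous on every
    step of the inductive limit and therefore on [E]: the topology of [p] is
    coarser than that of [E].

    For the reverse comparison, convergence for [p] implies pointwise
    convergence on [K], hence weak convergence since [f] is an embedding. So
    every continuous functional on [E] is bounded on the unit ball of [p], and
    what is left is Mackey's theorem that a weakly bounded set is bounded
    ([dominated_functionals_ball]). It rests on a gliding hump
    ([seminorm_dominated]): were a continuous seminorm [q] unbounded on the ball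
    of [p], a geometric series of functionals dominated by [q], provided by the
    Hahn-Banach theorem ([norming_functional]), would converge to a continuous
    functional unbounded on that ball.

    Conversely, if [E] is normed, its dual unit ball [K] is compact for
    pointwise convergence ([compact_dual_ball]), and evaluation maps [E] into
    [C_p(K)]. It is injective by the Hahn-Banach theorem, and it is a
    homeomorphism onto its range for the weak topology because [K] spans the
    dual. *)

Set Implicit Arguments.
Unset Strict Implicit.
Unset Printing Implicit Defensive.

Import Order.TTheory GRing.Theory Num.Theory.
Import numFieldNormedType.Exports.

Local Open Scope classical_set_scope.
Local Open Scope ring_scope.

(** * The Hahn-Banach theorem *)

(** Homogeneity is required as an inequality for positive scalars only; applied
    to a scalar and to its inverse it gives the equality. *)
Definition sublinear (R : realType) (E : lmodType R) (s : E -> R) :=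
  (forall x y, s (x + y) <= s x + s y) /\
  (forall c x, 0 < c -> s (c *: x) <= c * s x).

Section Sublinear.
Context (R : realType) (E : lmodType R).
Implicit Types s p : E -> R.

Lemma sublinear0 s : sublinear s -> s 0 = 0.
Proof.
move=> [_ sZ]; have c2 : 0 < 2 :> R by rewrite ltr0n.
have := sZ 2 0 c2; have := sZ 2^-1 0; rewrite !scaler0 invr_gt0 => /(_ c2).
lra.
Qed.

Lemma sublinearZ s c x : sublinear s -> 0 <= c -> s (c *: x) = c * s x.
Proof.
move=> ss; rewrite le0r => /predU1P[->|c0].
  by rewrite scale0r mul0r sublinear0.
apply/le_anti; rewrite (ss.2 _ _ c0)/=.
have := ss.2 c^-1 (c *: x); rewrite invr_gt0 => /(_ c0).
by rewrite scalerA mulVf ?gt_eqF// scale1r mulrC ler_pdivlMr// mulrC.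
Qed.

Lemma sublinear_oppr s x : sublinear s -> - s (- x) <= s x.
Proof.
move=> ss; have := ss.1 x (- x); rewrite subrr sublinear0//; lra.
Qed.

Let shift_values s y x := [set s (x + t *: y) - t * s y | t in [set t | 0 <= t]].

(** For sublinear [s] this is a sublinear functional below [s] whose value at
    [- y] is at most [- s y], the value that linearity along [y] would impose. *)
Definition sublinear_shift s y x := inf (shift_values s y x).

Let shift_lb s y x : sublinear s -> lbound (shift_values s y x) (- s (- x)).
Proof.
move=> ss _ [t /= t0 <-].
have := ss.1 (x + t *: y) (- x).
by rewrite addrAC subrr add0r sublinearZ//; lra.
Qed.

Lemma sublinear_shift_le s y x t : sublinear s -> 0 <= t ->
  sublinear_shift s y x <= s (x + t *: y) - t * s y.
Proof.
move=> ss t0; apply: ge_inf; last by exists t.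
by exists (- s (- x)); exact: shift_lb.
Qed.

Let le_shift s y x m : sublinear s ->
  (forall t, 0 <= t -> m <= s (x + t *: y) - t * s y) ->
  m <= sublinear_shift s y x.
Proof.
move=> ss h; apply: lb_le_inf; last by move=> _ [t t0 <-]; exact: h.
by exists (s (x + 0 *: y) - 0 * s y), 0 => /=.
Qed.

Lemma sublinear_sublinear_shift s y :
  sublinear s -> sublinear (sublinear_shift s y).
Proof.
move=> ss; split=> [x1 x2|c x c0].
  rewrite -lerBlDr; apply: le_shift => // t t0.
  rewrite lerBlDl -lerBlDr; apply: le_shift => // u u0.
  rewrite lerBlDr.
  apply: (le_trans (sublinear_shift_le y (x1 + x2) ss (addr_ge0 u0 t0))).
  have := ss.1 (x1 + t *: y) (x2 + u *: y).
  by rewrite addrACA -scalerDl (addrC t u); lra.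
rewrite -ler_pdivrMl//; apply: le_shift => // t t0.
rewrite ler_pdivrMl//.
apply: (le_trans (sublinear_shift_le y (c *: x) ss (mulr_ge0 (ltW c0) t0))).
by rewrite -scalerA -scalerDr sublinearZ ?(ltW c0)// mulrBr mulrA.
Qed.

(** Minimality forces [s] to agree with each of its shifts, and the shift in
    direction [y] lies below [s (x + y) - s y]; hence [s] is superadditive. *)
Lemma minimal_sublinear_linear s : sublinear s ->
  (forall t, sublinear t -> (forall x, t x <= s x) -> t = s) ->
  linear (s : E -> R^o).
Proof.
move=> ss smin.
have sD x y : s (x + y) = s x + s y.
  apply/le_anti; rewrite ss.1/=.
  have sx : sublinear_shift s y = s.
    apply: smin; first exact: sublinear_sublinear_shift.
    move=> z; have := sublinear_shift_le y z ss (lexx 0).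
    by rewrite scale0r addr0 mul0r subr0.
  have := sublinear_shift_le y x ss ler01.
  by rewrite sx scale1r mul1r; lra.
have sN x : s (- x) = - s x.
  by have := sD x (- x); rewrite subrr sublinear0//; lra.
move=> a x y; rewrite sD; congr +%R.
have [a0|a0] := leP 0 a; first by rewrite sublinearZ.
rewrite -[a]opprK scaleNr sN sublinearZ// ?oppr_ge0 ?ltW//.
by rewrite -mulNr.
Qed.

(** Zorn's lemma applies because the pointwise infimum of a chain is again
    sublinear: two members of the chain evaluated at [x] and [y] are both
    bounded below by the smaller of the two members. It is finite because a
    sublinear functional below [p] is bounded below at [x] by [- p (- x)]. *)
Lemma exists_minimal_sublinear p : sublinear p ->
  exists s, [/\ sublinear s, forall x, s x <= p x &
    forall t, sublinear t -> (forall x, t x <= s x) -> t = s].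
Proof.
move=> sp.
pose P s := sublinear s /\ forall x, s x <= p x.
pose T := {s : E -> R | P s}.
pose below (s t : T) := `[< forall x, sval t x <= sval s x >].
have [||||[s [ss sle]] smin] := @Zorn T below.
- by move=> t; apply/asboolP.
- move=> r s t /asboolP rs /asboolP st; apply/asboolP => x.
  exact: le_trans (st x) (rs x).
- move=> [s hs] [t ht] /asboolP st /asboolP ts; apply/eq_exist/funext => x.
  by apply/le_anti; rewrite st ts.
- move=> A tA; have [A0|/set0P[a0 Aa0]] := eqVneq A set0.
    by exists (exist P p (conj sp (fun x => lexx (p x)))) => s; rewrite A0.
  pose V x := [set sval a x | a in A].
  have Vlb x : lbound (V x) (- p (- x)).
    move=> _ [[a [sa ap]] _ <-] /=.
    by have := sublinear_oppr x sa; have := ap (- x); lra.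
  have infV_le a x : A a -> inf (V x) <= sval a x.
    by move=> Aa; apply: ge_inf; [exists (- p (- x)); exact: Vlb|exists a].
  have le_infV x m : (forall a, A a -> m <= sval a x) -> m <= inf (V x).
    move=> h; apply: lb_le_inf; first by exists (sval a0 x), a0.
    by move=> _ [a Aa <-]; exact: h.
  have sinf : sublinear (fun x => inf (V x)) /\ forall x, inf (V x) <= p x.
    split; last by move=> x; apply: le_trans (infV_le a0 x Aa0) _; case: (svalP a0).
    split=> [x y|c x c0].
      rewrite -lerBlDr; apply: (le_infV) => a Aa.
      rewrite lerBlDl -lerBlDr; apply: (le_infV) => b Ab; rewrite lerBlDr.
      have [/asboolP ab|/asboolP ba] := tA a b Aa Ab.
        apply: le_trans (infV_le b _ Ab) _; apply: le_trans ((svalP b).1.1 _ _) _.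
        by rewrite addrC lerD2l.
      apply: le_trans (infV_le a _ Aa) _; apply: le_trans ((svalP a).1.1 _ _) _.
      by rewrite addrC lerD2r.
    rewrite -ler_pdivrMl//; apply: (le_infV) => a Aa; rewrite ler_pdivrMl//.
    by apply: le_trans (infV_le a _ Aa) _; exact: (svalP a).1.2.
  by exists (exist P _ sinf) => a Aa; apply/asboolP => x; exact: infV_le.
exists s; split=> // t st ts.
have tp x : t x <= p x by exact: le_trans (ts x) (sle x).
by have /(congr1 sval) := smin (exist P t (conj st tp)) (introT (asboolP _) ts).
Qed.

(** Any minimal sublinear functional below the shift of [p] in direction [x0]
    is linear and is at most [- p x0] at [- x0], which pins its value at
    [x0]. *)
Theorem hahn_banach p x0 : sublinear p ->
  exists phi : {linear E -> R^o}, phi x0 = p x0 /\ forall x, phi x <= p x.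
Proof.
move=> sp.
have [s [ss sp0 smin]] :=
  exists_minimal_sublinear (sublinear_sublinear_shift x0 sp).
have ls := minimal_sublinear_linear ss smin.
pose phi : {linear E -> R^o} :=
  HB.pack (s : E -> R^o) (GRing.isLinear.Build R E R^o _ s ls).
have phip x : phi x <= p x.
  apply: le_trans (sp0 x) _; have := sublinear_shift_le x0 x sp (lexx 0).
  by rewrite scale0r addr0 mul0r subr0.
exists phi; split=> //; apply/le_anti; rewrite phip/=.
have := sp0 (- x0); have := sublinear_shift_le x0 (- x0) sp ler01.
rewrite scale1r addNr mul1r sublinear0//.
have -> : s (- x0) = - s x0 := linearN phi x0.
by move=> h1 h2; change (p x0 <= s x0); lra.
Qed.

End Sublinear.

(** * Seminorms and the gliding hump *)

Definition seminorm (R : realType) (E : lmodType R) (q : E -> R) :=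
  (forall x y, q (x + y) <= q x + q y) /\
  (forall c x, q (c *: x) = `|c| * q x).

Section Seminorm.
Context (R : realType) (E : lmodType R).
Implicit Types p q : E -> R.

Lemma seminorm0 q : seminorm q -> q 0 = 0.
Proof. by move=> [_ qZ]; rewrite -(scale0r 0) qZ normr0 mul0r. Qed.

Lemma seminormN q x : seminorm q -> q (- x) = q x.
Proof. by move=> [_ qZ]; rewrite -scaleN1r qZ normrN1 mul1r. Qed.

Lemma seminorm_ge0 q x : seminorm q -> 0 <= q x.
Proof.
move=> sq; have := sq.1 x (- x); rewrite subrr seminorm0// seminormN//; lra.
Qed.

Lemma norming_functional q x0 : seminorm q ->
  exists phi : {linear E -> R^o}, phi x0 = q x0 /\ forall x, `|phi x| <= q x.
Proof.
move=> sq.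
have [|phi [phix0 phiq]] := @hahn_banach R E q x0.
  by split=> [|c x c0]; [exact: sq.1|rewrite sq.2 gtr0_norm].
exists phi; split=> // x; rewrite ler_norml phiq andbT lerNl -linearN.
by rewrite -(seminormN x sq).
Qed.

(** Used to transfer linearity to a limit without any topology. *)
Lemma norm_le_geometric_eq0 (d C : R) :
  (forall n, `|d| <= C * 3^-1 ^+ n) -> d = 0.
Proof.
move=> h; apply/eqP/negPn/negP; rewrite -normr_gt0 => d0.
pose n := (Num.trunc (C / `|d|)).+1.
have : C / `|d| < n%:R by exact: truncnS_gt.
rewrite ltr_pdivrMr// => Cn; have := h n.
rewrite exprVn ler_pdivlMr ?exprn_gt0// => hn.
have : n%:R * `|d| <= 3 ^+ n * `|d|.
  by rewrite ler_pM2r// -natrX ler_nat ltnW// ltn_expl.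
by rewrite (mulrC (3 ^+ n)); move: Cn hn; lra.
Qed.

(** The error radius [3 / 2 * 3^-1 ^+ n * q x] is the tail of the geometric
    series, so the intervals of this radius around [phi_ n x] are nested and
    the limit can be taken as the supremum of their left ends. *)
Lemma linear_geometric_limit (phi_ : nat -> {linear E -> R^o}) q : seminorm q ->
  (forall n x, `|phi_ n.+1 x - phi_ n x| <= 3^-1 ^+ n * q x) ->
  exists phi : {linear E -> R^o},
    forall n x, `|phi x - phi_ n x| <= 3 / 2 * 3^-1 ^+ n * q x.
Proof.
move=> sq hphi.
pose e n x := 3 / 2 * 3^-1 ^+ n * q x.
pose a n x : R := phi_ n x + e n x; pose b n x : R := phi_ n x - e n x.
have e0 n x : 0 <= e n x.
  by rewrite !mulr_ge0 ?exprn_ge0 ?seminorm_ge0.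
have eS n x : e n x = 3^-1 ^+ n * q x + e n.+1 x.
  by rewrite /e exprS; field.
have aS n x : a n.+1 x <= a n x.
  have := hphi n x; rewrite /a (eS n) ler_norml => /andP[_].
  by move: (phi_ n x : R) (phi_ n.+1 x : R) => u v; lra.
have bS n x : b n x <= b n.+1 x.
  have := hphi n x; rewrite /b (eS n) ler_norml => /andP[+ _].
  by move: (phi_ n x : R) (phi_ n.+1 x : R) => u v; lra.
have a_mono x : {homo a^~ x : m n / (m <= n)%N >-> n <= m}.
  by apply: homo_leq => [//|y z t yz zt|n]; [exact: le_trans zt yz|exact: aS].
have b_mono x : {homo b^~ x : m n / (m <= n)%N >-> m <= n}.
  by apply: homo_leq => [//|y z t|n]; [exact: le_trans|exact: bS].
have ba m n x : b m x <= a n x.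
  apply: le_trans (b_mono x _ _ (leq_maxl m n)) _.
  apply: le_trans _ (a_mono x _ _ (leq_maxr m n)).
  by rewrite /a /b lerD2l; have := e0 (maxn m n) x; lra.
pose f x : R^o := sup [set b n x | n in setT].
have fP n x : `|f x - phi_ n x| <= e n x.
  have bf : b n x <= f x.
    apply: ub_le_sup; last by exists n.
    by exists (a 0%N x) => _ [k _ <-]; exact: ba.
  have fa : f x <= a n x.
    apply: ge_sup; first by exists (b 0%N x), 0%N.
    by move=> _ [k _ <-]; exact: ba.
  rewrite ler_norml; move: bf fa; rewrite /a /b.
  by move: (phi_ n x : R) (f x : R) => u v ? ?; lra.
have lf : linear f.
  move=> c x y; apply/eqP; rewrite -subr_eq0; apply/eqP.
  apply: (@norm_le_geometric_eq0 _
    (3 / 2 * (q (c *: x + y) + `|c| * q x + q y))) => n.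
  have -> : f (c *: x + y) - (c *: f x + f y) =
    (f (c *: x + y) - phi_ n (c *: x + y)) - c * (f x - phi_ n x)
     - (f y - phi_ n y).
    rewrite linearP -[c *: f x]/(c * f x) -[c *: phi_ n x]/(c * phi_ n x).
    by move: (f _ : R) (f x : R) (f y : R) (phi_ n x : R) (phi_ n y : R) => *; ring.
  apply: le_trans (ler_normB _ _) _.
  apply: le_trans (lerD (ler_normB _ _) (lexx _)) _.
  rewrite normrM.
  apply: (@le_trans _ _ (e n (c *: x + y) + `|c| * e n x + e n y)).
    by rewrite !lerD// ?fP// ler_wpM2l// fP.
  by rewrite /e le_eqVlt; apply/orP; left; apply/eqP; ring.
pose phi : {linear E -> R^o} := HB.pack f (GRing.isLinear.Build R E R^o _ f lf).
by exists phi => n x; exact: fP.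
Qed.

(** Gliding hump. If no multiple of [p] dominates [q], there are points [u n]
    with [q (u n) = 1] at which [p] decays faster than [3^-1 ^+ n]. A functional
    is built by successive corrections of size [3^-1 ^+ n], the sign of each
    being chosen so that the value at [u n] has modulus at least [3^-1 ^+ n].
    The later corrections sum to at most half of that, so the limit is dominated
    by a multiple of [q] but its values at the points [u n] are too large for it
    to be dominated by a multiple of [p]. *)
Theorem seminorm_dominated p q : seminorm p -> seminorm q ->
  (forall phi : {linear E -> R^o}, (exists C, forall x, `|phi x| <= C * q x) ->
     exists M, forall x, `|phi x| <= M * p x) ->
  exists M, forall x, q x <= M * p x.
Proof.
move=> sp sq dom; apply: contrapT => /forallNP unb.
have /choice[u uP] n : exists y, q y = 1 /\ n.+1%:R * p y <= 3^-1 ^+ n.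
  have /existsNP[x /negP] := unb (n.+1%:R * 3 ^+ n); rewrite -ltNge => hx.
  have qx : 0 < q x.
    by apply: le_lt_trans hx; rewrite !mulr_ge0 ?exprn_ge0 ?seminorm_ge0.
  exists ((q x)^-1 *: x); rewrite sq.2 sp.2 ger0_norm ?invr_ge0 ?(ltW qx)//.
  rewrite mulVf ?gt_eqF//; split=> //.
  rewrite exprVn -[leRHS]mul1r ler_pdivlMr ?exprn_gt0//.
  have -> : n.+1%:R * ((q x)^-1 * p x) * 3 ^+ n = n.+1%:R * 3 ^+ n * p x / q x.
    by rewrite mulrCA -!mulrA mulrC !mulrA; congr (_ * _); rewrite mulrAC.
  by rewrite ler_pdivrMr// mul1r ltW.
have /choice[next nextP] (a : nat * {linear E -> R^o}) :
    exists b : {linear E -> R^o},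
      (forall x, `|b x - a.2 x| <= 3^-1 ^+ a.1 * q x) /\
      3^-1 ^+ a.1 <= `|b (u a.1)|.
  case: a => n phi /=.
  have [psi [psiu psiq]] := norming_functional (u n) sq.
  have t0 : 0 <= 3^-1 ^+ n :> R by rewrite exprn_ge0.
  have bnd c x : `|c| = 3^-1 ^+ n ->
      `|(phi \+ c \*: psi) x - phi x| <= 3^-1 ^+ n * q x.
    move=> ct; rewrite /= addrAC subrr add0r normrZ ct ler_wpM2l//.
  (* of two numbers that differ by 2 t, one has modulus at least t *)
  have [h|h] := leP (3^-1 ^+ n) `|(phi \+ (3^-1 ^+ n) \*: psi) (u n)|.
    exists (phi \+ (3^-1 ^+ n) \*: psi); split=> // x.
    by apply: bnd; rewrite ger0_norm.
  exists (phi \+ (- 3^-1 ^+ n) \*: psi); split=> [x|].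
    by apply: bnd; rewrite normrN ger0_norm.
  move: h => /=; rewrite psiu (uP n).1 scaleNr.
  rewrite -[3^-1 ^+ n *: 1]/(3^-1 ^+ n * 1) mulr1.
  by move: (phi (u n) : R) (3^-1 ^+ n) t0 => v t t0; rewrite ltr_norml ler_normr; lra.
pose fix phi_ n : {linear E -> R^o} :=
  if n is m.+1 then next (m, phi_ m) else \0.
have [phi phiP] : exists phi : {linear E -> R^o},
    forall n x, `|phi x - phi_ n x| <= 3 / 2 * 3^-1 ^+ n * q x.
  by apply: linear_geometric_limit => // n x; exact: (nextP (n, phi_ n)).1.
have [|M phiM] := dom phi.
  exists (3 / 2) => x; have := phiP 0%N x.
  by rewrite /= expr0 mulr1 subr0.
pose n := Num.trunc (2 * M).
have Mn : 2 * M < n.+1%:R by exact: truncnS_gt.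
have h1 : 3^-1 ^+ n <= `|phi_ n.+1 (u n)| := (nextP (n, phi_ n)).2.
have h2 := phiP n.+1 (u n); rewrite (uP n).1 mulr1 exprS in h2.
have h3 := phiM (u n); have h4 := (uP n).2.
have t0 : 0 < 3^-1 ^+ n :> R by rewrite exprn_gt0.
have h5 : 3^-1 ^+ n <= 2 * M * p (u n).
  have := ler_distD 0 (phi_ n.+1 (u n)) (phi (u n)).
  have := lerB_dist (phi_ n.+1 (u n)) (phi (u n)).
  rewrite (distrC (phi_ _ _)).
  by move: `|phi_ n.+1 (u n)| `|phi (u n)| `|_ - _| h1 h2 h3 => *; lra.
have [p0|p0] := eqVneq (p (u n)) 0.
  by move: h5; rewrite p0 mulr0 leNgt t0.
have : 2 * M * p (u n) < n.+1%:R * p (u n).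
  by rewrite ltr_pM2r// lt0r p0 seminorm_ge0.
by rewrite ltNge (le_trans h4).
Qed.

End Seminorm.

(** * Gauges in locally convex spaces *)

Lemma convex_combination (R : realType) (E : lmodType R) (W : set E) (t : R) x y :
  convex_set (W : set (convex_lmodType E)) -> W x -> W y -> 0 <= t -> t <= 1 ->
  W (t *: x + (1 - t) *: y).
Proof.
move=> cW Wx Wy t0 t1.
by have := cW x y (Itv01 t0 t1) (mem_set Wx) (mem_set Wy); rewrite inE.
Qed.

(** The seminorm is the gauge of a convex neighbourhood of the origin contained
    in [U], made symmetric by intersecting it with its opposite. *)
Lemma tvs_seminorm (R : realType) (E : tvsType R) (U : set E) : nbhs 0 U ->
  exists q : E -> R, [/\ seminorm q, forall x, q x < 1 -> U x &
    nbhs 0 [set x | q x <= 1]].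
Proof.
move=> U0.
have [B cB [oB bB]] := @locally_convex R E.
have [W [BW W0] WU] := bB 0 U U0.
have cW := cB W (mem_set BW).
pose V x := W x /\ W (- x).
have nW : nbhs 0 W by apply: open_nbhs_nbhs; split=> //; exact: oB.
have nV : nbhs 0 V.
  apply: filterI => //; apply: filterS (nbhs0N nW) => x [y Wy <-].
  by rewrite opprK.
have cV t x y : V x -> V y -> 0 <= t -> t <= 1 -> V (t *: x + (1 - t) *: y).
  move=> [Wx WNx] [Wy WNy] t0 t1; split; first exact: convex_combination.
  by rewrite opprD -!scalerN; exact: convex_combination.
have V0 : V 0 by rewrite /V oppr0.
have VN x : V x -> V (- x) by move=> []; rewrite /V opprK.
pose G x := [set t | 0 < t /\ V (t^-1 *: x)].
(* continuity of scaling at the scalar 0 makes [V] absorbing *)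
have G0 x : G x !=set0.
  have /= := @scale_continuous R E (0, x) V; rewrite scale0r => /(_ nV).
  move=> [[A1 A2] [/= [e e0 eA1] A2x] AV].
  have e2 : 0 < e / 2 by rewrite divr_gt0.
  exists (e / 2)^-1; split; first by rewrite invr_gt0.
  rewrite invrK; apply: (AV (e / 2, x)); split=> /=; last exact: nbhs_singleton.
  by apply: eA1; rewrite /= sub0r normrN gtr0_norm// ltr_pdivrMr// ltr_pMr// ltr1n.
have Glb x : has_lbound (G x) by exists 0 => t [/ltW].
pose q x := inf (G x).
have qG x t : G x t -> q x <= t by move=> Gt; exact: ge_inf.
have q_le x m : (forall t, G x t -> m <= t) -> m <= q x by exact: lb_le_inf.
have q_ge0 x : 0 <= q x by apply: (q_le) => t [/ltW].
have qZle c x : c != 0 -> q (c *: x) <= `|c| * q x.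
  move=> c0; have nc : 0 < `|c| by rewrite normr_gt0.
  rewrite -ler_pdivrMl//; apply: (q_le) => t [t0 Vt]; rewrite ler_pdivrMl//.
  apply: (qG); split; first by rewrite mulr_gt0.
  have -> : (`|c| * t)^-1 *: (c *: x) = (c / `|c|) *: (t^-1 *: x).
    by rewrite !scalerA; congr (_ *: _); rewrite invfM; ring.
  have [cp|cn] := leP 0 c; first by rewrite ger0_norm// divff// scale1r.
  by rewrite ltr0_norm// invrN mulrN divff// scaleN1r; exact: VN.
have q0 : q 0 = 0.
  apply/le_anti; rewrite q_ge0 andbT; apply/ler_addgt0Pl => e e0.
  by rewrite addr0; apply: (qG); split=> //; rewrite scaler0.
exists q; split.
- split=> [x y|c x].
    rewrite -lerBlDr; apply: (q_le) => s [s0 Vs].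
    rewrite lerBlDl -lerBlDr; apply: (q_le) => t [t0 Vt].
    rewrite lerBlDr; apply: (qG).
    have st0 : 0 < t + s by rewrite addr_gt0.
    split=> //.
    have -> : (t + s)^-1 *: (x + y) =
        (s / (t + s)) *: (s^-1 *: x) + (1 - s / (t + s)) *: (t^-1 *: y).
      rewrite scalerDr !scalerA; congr (_ *: _ + _ *: _); field;
      by rewrite ?gt_eqF.
    apply: cV => //; first by rewrite divr_ge0// ltW.
    by rewrite ler_pdivrMr// mul1r lerDr ltW.
  have [->|c0] := eqVneq c 0; first by rewrite scale0r normr0 mul0r.
  apply/le_anti; rewrite qZle//=.
  rewrite -ler_pdivlMl ?normr_gt0// -normfV.
  apply: le_trans (qZle _ _ _); last by rewrite invr_eq0.
  by rewrite scalerA mulVf// scale1r.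
- move=> x; rewrite ltNge => /negP qx; apply: WU.
  have [t [t0 [Wt _]] t1] : exists2 t, G x t & t <= 1.
    apply: contrapT => h; apply: qx; apply: (q_le) => t Gt.
    by rewrite leNgt; apply/negP => t1; apply: h; exists t => //; exact: ltW.
  have := convex_combination cW Wt W0 (ltW t0) t1.
  by rewrite scalerA divff ?gt_eqF// scale1r scaler0 addr0.
- by apply: filterS nV => x Vx; apply: (qG); split=> //; rewrite invr1 scale1r.
Qed.

(** * Baire's theorem for complete metric spaces *)

(** Baire's theorem for a countable closed cover. If no member of the cover
    had an interior point, every ball would meet the complement of each member,
    which yields nested closed balls of radii tending to [0], one avoiding
    [C n] for each [n]; their centres converge to a point in no member. *)
Lemma complete_metric_baire (R : realType) (M : metricType R)
    (C : nat -> set M) (x0 : M) :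
  (forall F : set_system M, ProperFilter F -> cauchy F -> exists x : M, F --> x) ->
  (forall n, closed (C n)) -> \bigcup_n C n = [set: M] ->
  exists n (x : M), nbhs x (C n).
Proof.
move=> cM clC Ccover; apply: contrapT => noC.
pose dist : M -> M -> R := mdist.
have nb (x : M) (r : R) : 0 < r -> nbhs x [set y | dist x y < r].
  by move=> r0; rewrite -ballEmdist; exact: nbhsx_ballx.
(* the inequality between centres and radii says that the new closed ball is
   contained in the old one *)
have /choice[next nextP] (a : nat * (M * {posnum R})) : exists b : M * {posnum R},
    [/\ dist a.2.1 b.1 + b.2%:num <= a.2.2%:num,
        b.2%:num <= 2^-1 ^+ a.1 &
        forall y, dist b.1 y <= b.2%:num -> ~ C a.1 y].
  case: a => n [x r] /=.
  have [y [xy Cy]] : exists y, dist x y < r%:num /\ ~ C n y.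
    apply: contrapT => /forallNP h; apply: noC; exists n, x.
    apply: filterS (nb x r%:num _) => // y xy.
    by apply: contrapT => Cy; exact: (h y).
  have : nbhs y (~` C n) by apply: open_nbhs_nbhs; split=> //; exact: closed_openC.
  rewrite -nbhs_ballE => -[e e0]; rewrite ballEmdist => yC.
  (* halving [e] makes the closed ball of the new radius avoid [C n] *)
  have d0 : 0 < Num.min (e / 2) (Num.min (r%:num - dist x y) (2^-1 ^+ n)).
    by rewrite !lt_min divr_gt0// subr_gt0 xy exprn_gt0.
  exists (y, PosNum d0); split=> /=.
  - by rewrite -lerBrDl ge_min ge_min lexx orbT.
  - by rewrite !ge_min lexx !orbT.
  - move=> z yz; apply: yC => /=; apply: le_lt_trans yz _.
    rewrite gt_min ltr_pdivrMr// ltr_pMr// ltr1n//.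
pose one : {posnum R} := PosNum ltr01.
pose fix a n : M * {posnum R} := if n is m.+1 then next (m, a m) else (x0, one).
pose x n := (a n).1; pose r n := (a n).2%:num.
have aP n := nextP (n, a n).
have dist_le m n : (m <= n)%N -> dist (x m) (x n) <= r m - r n.
  elim: n => [|n IH]; first by rewrite leqn0 => /eqP->; rewrite /dist mdistxx subrr.
  rewrite leq_eqVlt => /predU1P[->|]; first by rewrite /dist mdistxx subrr.
  rewrite ltnS => /IH mn; have [+ _ _] := aP n.
  rewrite -/(x n) -/(r n) -/(a n.+1) -/(x n.+1) -/(r n.+1).
  have := metric_triangle (x m) (x n) (x n.+1); rewrite -/dist.
  by move: mn; lra.
have dist_r m n : (m <= n)%N -> dist (x m) (x n) <= r m.
  by move=> mn; apply: le_trans (dist_le _ _ mn) _; rewrite gerBl /r.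
have r_small (e : R) : 0 < e -> exists n, r n < e.
  move=> e0; pose k := Num.trunc e^-1.
  have ke : e^-1 < k.+1%:R by exact: truncnS_gt.
  exists k.+2; have [_ + _] := aP k.+1; rewrite -/(r k.+2) => /le_lt_trans; apply.
  rewrite exprVn invf_plt ?posrE ?exprn_gt0//; apply: lt_le_trans ke _.
  by rewrite -natrX ler_nat ltnW// ltn_expl.
have cx : cauchy (x @ \oo).
  apply: cauchy_exP => e e0; have [n rn] := r_small e e0; exists (x n).
  rewrite ballEmdist; exists n => // k /= nk.
  exact: le_lt_trans (dist_r _ _ nk) rn.
have [l xl] := cM _ _ cx.
have dist_l n : dist (x n) l <= r n.
  apply/ler_addgt0Pl => e e0.
  have := xl _ (nb l e e0); rewrite near_simpl => -[m _ hm].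
  have := hm (maxn m n) (leq_maxl _ _); rewrite /= {1}/dist metric_sym -/dist => lm.
  apply: le_trans (metric_triangle _ (x (maxn m n)) _) _.
  by rewrite addrC lerD// ?(ltW lm)// dist_r// leq_maxr.
have [n _ Cl] : (\bigcup_n C n) l by rewrite Ccover.
by have [_ _ /(_ l (dist_l n.+1))] := aP n.
Qed.

(** * Continuity of seminorms and linear maps *)

Lemma seminorm_nbhs0 (R : realType) (E : tvsType R) (q : E -> R) (M e : R) :
  seminorm q -> 0 < M -> 0 < e ->
  nbhs 0 [set x | q x <= M] -> nbhs 0 [set x | q x <= e].
Proof.
move=> sq M0 e0 nq; have c0 : e / M != 0 by rewrite gt_eqF// divr_gt0.
apply: filterS (nbhs0Z c0 nq) => _ [x /= qx <-].
rewrite /= sq.2 gtr0_norm ?divr_gt0// mulrAC ler_pdivrMr//.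
by rewrite ler_pM2l.
Qed.

Lemma linear_continuous0 (R : realType) (E F : tvsType R) (f : {linear E -> F}) :
  (forall U, nbhs 0 U -> nbhs 0 (f @^-1` U)) -> continuous f.
Proof.
move=> f0 x U Ux.
have V0 : nbhs 0 [set z | U (f x + z)].
  have := nbhsB (- f x) Ux; rewrite addNr; apply: filterS => _ [z Uz <-] /=.
  by rewrite addNKr.
by apply: filterS (nbhsT x (f0 _ V0)) => _ [z Uz <-] /=; rewrite linearD.
Qed.

Lemma seminorm_dominated_continuous (R : realType) (E : tvsType R)
    (V : normedModType R) (f : {linear E -> V}) (q : E -> R) (C : R) :
  seminorm q -> nbhs 0 [set x | q x <= 1] -> (forall x, `|f x| <= C * q x) ->
  continuous f.
Proof.
move=> sq nq fq; apply: linear_continuous0 => U /nbhs_norm0P[e /= e0 eU].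
pose K := `|C| + 1; have K0 : 0 < K by rewrite /K ltr_wpDl.
have eK : 0 < e / K / 2 by rewrite !divr_gt0.
apply: filterS (seminorm_nbhs0 sq ltr01 eK nq) => x /= qx; apply: eU => /=.
apply: le_lt_trans (fq x) _; apply: (@le_lt_trans _ _ (K * q x)).
  by rewrite ler_wpM2r ?seminorm_ge0// (le_trans (ler_norm C))// lerDl.
apply: (@le_lt_trans _ _ (e / 2)); last by rewrite ltr_pdivrMr// ltr_pMr// ltr1n.
by rewrite -ler_pdivlMl// mulrC mulrAC.
Qed.

(** A Frechet space is barrelled. The closed sets [q <= n] cover the space, so
    one of them has an interior point by Baire's theorem; translating it to the
    origin bounds [q] near [0], and homogeneity does the rest. *)
Lemma barrelled_seminorm (R : realType) (S : tvsType R) (q : S -> R) :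
  completely_metrizable R S -> seminorm q ->
  (forall t, closed [set x | q x <= t]) -> nbhs 0 [set x | q x <= 1].
Proof.
move=> [M [f [[cf [g [fK gK cg]]] cM]]] sq clq.
pose C n : set M := g @^-1` [set x | q x <= n%:R].
have [||n [y Cy]] := @complete_metric_baire R M C (f 0) cM.
- by move=> n; apply: closed_comp => // ? _; exact: cg.
- rewrite -subTset => y _; exists (Num.trunc (q (g y))).+1 => //=.
  by rewrite /C /= ltW// truncnS_gt.
have nx : nbhs (g y) [set x | q x <= n%:R].
  have fC : nbhs (g y) (f @^-1` C n) by apply: cf; rewrite gK.
  by apply: filterS fC => x; rewrite /C /= fK.
have := nbhsB (- g y) nx; rewrite addNr => n0.
have M0 : 0 < n%:R + q (g y) + 1.
  by have := ler0n R n; have := seminorm_ge0 (g y) sq; lra.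
apply: (seminorm_nbhs0 sq M0 ltr01); apply: filterS n0 => _ [x /= qx <-] /=.
apply: le_trans (sq.1 _ _) _; rewrite seminormN//; move: qx; lra.
Qed.

(** * The topologies of pointwise convergence *)

Lemma continuous_ptws (T V : topologicalType) (U : Type) (h : T -> {ptws U -> V}) :
  (forall u, continuous (fun x => h x u)) -> continuous h.
Proof.
move=> ch x; apply/cvg_sup => u.
exact: (@continuous_comp_initial _ _ _ (fun g : U -> V => g u) h (ch u) x).
Qed.

Lemma ptws_eval_continuous (V : topologicalType) (U : Type) (u : U) :
  continuous (fun g : {ptws U -> V} => g u).
Proof.
move=> g; have /cvg_sup/(_ u) cg : nbhs g --> g by exact: cvg_id.
exact: cvg_trans (cvg_app _ cg)
  (@initial_continuous _ _ (fun g : U -> V => g u) g).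
Qed.

Section WeakTopology.
Context (R : realType) (E : tvsType R).

Lemma continuous_into_weak (T : topologicalType) (h : T -> weak_space E) :
  (forall phi : dual E, continuous (fun x => sval phi (h x) : R^o)) ->
  continuous h.
Proof.
move=> ch; apply: (@continuous_comp_initial _ _ _ (@dual_eval R E)).
exact: continuous_ptws.
Qed.

Lemma weak_functional_continuous (phi : dual E) :
  continuous (fun x : weak_space E => sval phi x : R^o).
Proof.
move=> x; have h1 := @initial_continuous _ _ (@dual_eval R E) x.
have h2 := @ptws_eval_continuous R^o _ phi (dual_eval x).
exact: (continuous_comp h1 h2).
Qed.

Lemma to_weak_continuous : continuous (id : E -> weak_space E).
Proof. by apply: continuous_into_weak => phi; exact: (svalP phi). Qed.

End WeakTopology.

Section CpTopology.
Context (R : realType) (K : topologicalType).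

Lemma continuous_into_Cp (T : topologicalType) (h : T -> Cp R K) :
  (forall k, continuous (fun x => h x k)) -> continuous h.
Proof.
move=> ch; apply: (@continuous_comp_initial _ _ {ptws K -> R^o} (@Cp_fun R K)).
exact: continuous_ptws.
Qed.

Lemma nonexpansive_into_Cp (V : normedModType R) (h : V -> Cp R K) :
  (forall x y k, `|h x k - h y k| <= `|x - y|) -> continuous h.
Proof.
move=> hle; apply: continuous_into_Cp => k x; apply/cvgrPdist_lt => e e0.
near=> y; apply: le_lt_trans (hle x y k) _.
by near: y; exact: cvgr_dist_lt.
Unshelve. all: by end_near. Qed.

Lemma Cp_eval_continuous (k : K) : continuous (fun h : Cp R K => h k).
Proof.
move=> h; have h1 := @initial_continuous _ {ptws K -> R^o} (@Cp_fun R K) h.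
have h2 := @ptws_eval_continuous R^o _ k (h : K -> R^o).
exact: (continuous_comp h1 h2).
Qed.

Lemma Cp_bounded (h : Cp R K) : compact [set: K] ->
  exists M, forall k, `|h k| <= M.
Proof.
move=> cK; have ch : continuous h by apply/asboolP; exact: Cp_funP.
have : compact (range h).
  by apply: continuous_compact => //; exact: continuous_subspaceT.
move=> /(@compact_bounded R R^o)/pinfty_ex_gt0[M _ hM].
by exists M => k; apply: (hM (h k)); exists k.
Qed.

End CpTopology.

Lemma continuous_comp_within (T U W : topologicalType) (A : set U)
    (h : T -> U) (g : U -> W) : continuous h -> (forall x, A (h x)) ->
  {within A, continuous g} -> continuous (g \o h).
Proof.
move=> ch Ah cg x N gN.
have AN : nbhs (h x) (fun y => A y -> N (g y)).
  by move: (cg (h x) _ gN); rewrite /nbhs/= -nbhs_subspace_in ?inE.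
by apply: filterS (ch x _ AN : nbhs x (h @^-1` _)) => y /(_ (Ah y)).
Qed.

(** * Normability from an embedding in a function space *)

(** A copy of [E] that carries the proofs about [p], so that the normed module
    structure defined by [p] can be attached to the type. *)
Definition renormed (R : realType) (E : lmodType R) (p : E -> R)
  of seminorm p & (forall x, p x = 0 -> x = 0) : Type := E.

Section Renormed.
Context (R : realType) (E : lmodType R) (p : E -> R).
Hypotheses (sp : seminorm p) (p_eq0 : forall x, p x = 0 -> x = 0).
Local Notation V := (renormed sp p_eq0).

HB.instance Definition _ := GRing.Lmodule.copy V E.
HB.instance Definition _ := @Lmodule_isNormed.Build R V p sp.1 sp.2 p_eq0.

Definition to_renormed : E -> V := id.

Lemma to_renormed_linear : linear to_renormed. Proof. by []. Qed.

HB.instance Definition _ :=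
  GRing.isLinear.Build R E V _ to_renormed to_renormed_linear.

Definition of_renormed : V -> E := id.

Lemma of_renormed_linear : linear of_renormed. Proof. by []. Qed.

HB.instance Definition _ :=
  GRing.isLinear.Build R V E _ of_renormed of_renormed_linear.

End Renormed.

(** Mackey's theorem: a set on which every continuous functional is bounded,
    here the unit ball of [p], is absorbed by every neighbourhood of the origin.
    A functional dominated by a continuous seminorm [q] is continuous, hence
    dominated by [p]; the gliding hump then gives [q <= M * p]. *)
Theorem dominated_functionals_ball (R : realType) (E : tvsType R) (p : E -> R) :
  seminorm p ->
  (forall phi : dual E, exists M, forall x, `|sval phi x| <= M * p x) ->
  forall U, nbhs 0 U -> exists2 e, 0 < e & forall x, p x < e -> U x.
Proof.
move=> sp domE U /tvs_seminorm[q [sq qU nq]].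
have [phi [C phiC]|M qM] := seminorm_dominated sp sq.
  have cphi := seminorm_dominated_continuous sq nq phiC.
  by have [M phiM] := domE (exist _ phi cphi); exists M.
have K0 : 0 < `|M| + 1 by rewrite ltr_wpDl.
exists (`|M| + 1)^-1; first by rewrite invr_gt0.
move=> x px; apply: qU; apply: le_lt_trans (qM x) _.
apply: (@le_lt_trans _ _ ((`|M| + 1) * p x)).
  by rewrite ler_wpM2r ?seminorm_ge0// (le_trans (ler_norm M))// lerDl.
by rewrite -ltr_pdivlMl// mulr1.
Qed.

Section UniformSeminorm.
Context (R : realType) (E : lmodType R) (K : topologicalType).
Context (f : {linear E -> Cp R K}).

(** The sup norm of the continuous function [f x]; for empty [K] it is [0], the
    supremum of the empty set being [0]. *)
Definition uniform_seminorm x := sup [set `|f x k| | k in [set: K]].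

Hypothesis cK : compact [set: K].

Lemma le_uniform_seminorm x k : `|f x k| <= uniform_seminorm x.
Proof.
apply: ub_le_sup; last by exists k.
by have [M fM] := Cp_bounded (f x) cK; exists M => _ [l _ <-].
Qed.

Lemma uniform_seminorm_ge0 x : 0 <= uniform_seminorm x.
Proof.
have [[k _]|K0] := pselect ([set: K] !=set0).
  exact: le_trans (le_uniform_seminorm x k).
by rewrite /uniform_seminorm; move/nonemptyPn: K0 => ->; rewrite image_set0 sup0.
Qed.

Lemma uniform_seminorm_le x M : 0 <= M ->
  (uniform_seminorm x <= M) <-> (forall k, `|f x k| <= M).
Proof.
move=> M0; split=> [fM k|fM]; first exact: le_trans (le_uniform_seminorm x k) fM.
have [[k _]|K0] := pselect ([set: K] !=set0).
  by apply: ge_sup => [|_ [l _ <-]//]; exists `|f x k|, k.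
by rewrite /uniform_seminorm; move/nonemptyPn: K0 => ->; rewrite image_set0 sup0.
Qed.

Lemma seminorm_uniform_seminorm : seminorm uniform_seminorm.
Proof.
have fZ c x k : `|f (c *: x) k| = `|c| * `|f x k| by rewrite linearZ -normrM.
have fZle c x : uniform_seminorm (c *: x) <= `|c| * uniform_seminorm x.
  apply/uniform_seminorm_le => [|k]; first by rewrite mulr_ge0 ?uniform_seminorm_ge0.
  by rewrite fZ ler_wpM2l ?le_uniform_seminorm.
split=> [x y|c x].
  apply/uniform_seminorm_le => [|k]; first by rewrite addr_ge0 ?uniform_seminorm_ge0.
  rewrite linearD; apply: le_trans (ler_normD _ _) _.
  by rewrite lerD ?le_uniform_seminorm.
apply/le_anti; rewrite fZle/=; have [->|c0] := eqVneq c 0.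
  by rewrite normr0 mul0r uniform_seminorm_ge0.
rewrite -ler_pdivlMl ?normr_gt0// -normfV.
by apply: le_trans (fZle _ _); rewrite scalerA mulVf// scale1r.
Qed.

End UniformSeminorm.

Lemma closed_sublevel_uniform_seminorm (R : realType) (S : topologicalType)
    (E : lmodType R) (K : topologicalType) (f : {linear E -> Cp R K}) (i : S -> E) :
  compact [set: K] -> (forall k, continuous (fun x => f (i x) k)) ->
  forall t, closed [set x | uniform_seminorm f (i x) <= t].
Proof.
move=> cK ci t; have [t0|t0] := leP 0 t; last first.
  rewrite (_ : mkset _ = set0); first exact: closed0.
  apply/seteqP; split=> // x /= /le_lt_trans/(_ t0).
  by rewrite ltNge uniform_seminorm_ge0.
rewrite (_ : mkset _ = \bigcap_(k in [set: K]) [set x | `|f (i x) k| <= t]).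
  apply: closed_bigI => k _.
  apply: (@closed_comp _ _ (fun x => `|f (i x) k|) [set u | u <= t]).
    move=> x _.
    exact: (continuous_comp (ci k x) (@norm_continuous R R^o (f (i x) k))).
  exact: closed_le.
apply/seteqP; split=> x /=.
  by move=> /(uniform_seminorm_le f cK _ t0) h k _; exact: h.
by move=> h; apply/(uniform_seminorm_le f cK _ t0) => k; exact: h.
Qed.

(** The norm [p] is lower semicontinuous on [E], hence continuous on each step
    by barrelledness, so the identity from [E] to [(E, p)] is continuous by the
    universal property of the inductive limit. Conversely the identity from
    [(E, p)] to the weak space is continuous, because uniform convergence on [K]
    implies pointwise convergence and [f] is an embedding; so continuous
    functionals on [E] are dominated by [p] and Mackey's theorem applies. *)
Theorem LF_Eberlein_Grothendieck_normable (R : realType) (E : tvsType R) :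
  is_LF E -> linearly_Eberlein_Grothendieck (weak_space E) -> normable E.
Proof.
move=> [hsE [S [i [j [fS _ _ _ [ci iE]]]]]] [K [cK _ [f [cf [g [fK cg]]]]]].
pose p : E -> R := uniform_seminorm f.
have sp : seminorm p := seminorm_uniform_seminorm f cK.
have p_eq0 x : p x = 0 -> x = 0.
  move=> px; apply: (can_inj fK); rewrite linear0; apply/val_inj/funext => k.
  have := le_uniform_seminorm f cK x k; rewrite -/(p x) px.
  by rewrite normr_le0 => /eqP.
pose V := renormed sp p_eq0.
have cfE k : continuous (fun x : E => f x k).
  move=> x; apply: continuous_comp (@Cp_eval_continuous _ _ k _).
  by apply: continuous_comp (cf _); exact: to_weak_continuous.
have cEV : continuous (to_renormed sp p_eq0).
  apply: iE; first by exists id.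
  move=> n; have spn : seminorm (fun x => p (i n x)).
    by split=> [x y|c x]; rewrite ?linearD ?linearZ; [exact: sp.1|exact: sp.2].
  apply: (@seminorm_dominated_continuous _ _ V
    (to_renormed sp p_eq0 \o i n) (fun x => p (i n x)) 1 spn).
    apply: barrelled_seminorm (fS n) spn _.
    apply: closed_sublevel_uniform_seminorm => // k x.
    exact: (continuous_comp (ci n x) (cfE k _)).
  by move=> x; rewrite mul1r.
have cVf : continuous (fun x : V => f x : Cp R K).
  apply: (@nonexpansive_into_Cp _ _ V) => x y k.
  rewrite -[f x k - f y k]/((f x - f y) k) -linearB.
  exact: le_uniform_seminorm.
have cVw : continuous (id : V -> weak_space E).
  have := continuous_comp_within cVf (fun x => imageT _ x) cg.
  by rewrite (_ : g \o _ = id)//; apply/funext => x; exact: fK.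
have domE (phi : dual E) : exists M, forall x, `|sval phi x| <= M * p x.
  pose h : {linear V -> R^o} := sval phi \o @of_renormed R E p sp p_eq0.
  have ch : {for 0, continuous h}.
    exact: (continuous_comp (cVw 0) (@weak_functional_continuous R E phi 0)).
  have /linear_boundedP/pinfty_ex_gt0[M _ hM] := continuous_linear_bounded 0 ch.
  by exists M => x; exact: (hM x).
exists V, (to_renormed sp p_eq0); split=> //.
exists (@of_renormed R E p sp p_eq0); split=> //.
apply: linear_continuous0 => U /(dominated_functionals_ball sp domE)[e e0 eU].
by apply/(@nbhs_norm0P _ V); exists e.
Qed.

(** * The dual unit ball *)

Lemma injective_hausdorff (T U : topologicalType) (f : T -> U) :
  continuous f -> injective f -> hausdorff_space U -> hausdorff_space T.
Proof.
move=> cf injf hU p q pq; apply/injf/hU => A B /cf pA /cf qB.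
by have [x [Ax Bx]] := pq _ _ pA qB; exists (f x).
Qed.

Lemma compact_set_type (T : topologicalType) (A : set T) :
  compact A -> compact [set: set_type A].
Proof.
move=> cA F FF _.
have AF : F [set x : set_type A | A (set_val x)].
  by apply: filterS filterT => x _; exact: set_valP.
have [p [Ap Fp]] := cA (set_val @ F) _ AF.
exists (exist _ p (mem_set Ap)); split=> // B N FB [_ [[W oW <-] Wp WN]].
have nW : nbhs p W by apply: open_nbhs_nbhs.
have FVB : F [set x : set_type A | (set_val @` B) (set_val x)].
  by apply: filterS FB => x Bx; exists x.
have [_ [[x Bx <-] Wx]] := Fp _ _ FVB nW.
by exists x; split=> //; exact: WN.
Qed.

Section DualBall.
Context (R : realType) (V : normedModType R).

Definition dual_ball : set {ptws V -> R^o} :=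
  [set g | linear (g : V -> R^o) /\ forall x, `|g x| <= `|x|].

(** Linearity and the norm bound are conjunctions of conditions on finitely
    many values each, hence closed for pointwise convergence. *)
Lemma closed_dual_ball : closed dual_ball.
Proof.
pose L (a : R * V * V) : set {ptws V -> R^o} :=
  (fun g => g (a.1.1 *: a.1.2 + a.2) - (a.1.1 *: g a.1.2 + g a.2)) @^-1` [set 0].
pose N (x : V) : set {ptws V -> R^o} :=
  (fun g => `|g x|) @^-1` [set r | r <= `|x|].
rewrite (_ : dual_ball = (\bigcap_(a in setT) L a) `&` (\bigcap_(x in setT) N x)).
  have ev u : continuous (fun g : {ptws V -> R^o} => g u).
    exact: ptws_eval_continuous.
  apply: closedI.
    apply: (@closed_bigI {ptws V -> R^o}) => a _.
    apply: (@closed_comp {ptws V -> R^o} R^o); last exact: closed_eq.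
    move=> g _; exact: (cvgB (ev _ g)
      (cvgD (@cvgZl_tmp _ _ _ _ _ a.1.1 _ _ (ev a.1.2 g)) (ev _ g))).
  apply: (@closed_bigI {ptws V -> R^o}) => x _.
  apply: (@closed_comp {ptws V -> R^o} R^o); last exact: closed_le.
  move=> g _; exact: (continuous_comp (ev x g) (@norm_continuous R R^o (g x))).
apply/seteqP; split=> [g [lg ng]|g [Lg Ng]].
  by split=> [[[c x] y] _|x _]; [rewrite /L /= lg subrr|exact: ng].
split=> [c x y|x]; last exact: Ng.
by apply/eqP; rewrite -subr_eq0; apply/eqP; exact: (Lg (c, x, y)).
Qed.

(** Banach-Alaoglu: the ball is a closed subset of the product of the compact
    intervals of radius [`|x|]. *)
Lemma compact_dual_ball : compact dual_ball.
Proof.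
apply: (subclosed_compact closed_dual_ball
  (@tychonoff V (fun=> R^o) (fun x => `[- `|x|, `|x|]%classic) _)).
  by move=> x; exact: segment_compact.
by move=> g [_ ng] x /=; rewrite in_itv/= -ler_norml.
Qed.

End DualBall.

(** * Embedding a normable space in a function space *)

Section DualBallEvaluation.
Context (R : realType) (V : normedModType R).
Local Notation K := (set_type (@dual_ball R V)).

Lemma dual_ball_eval_continuous (x : V) :
  (fun k : K => set_val k x : R^o) \in @continuous_pred R K.
Proof.
apply/asboolP => k; have h1 := @initial_continuous K _ set_val k.
have h2 := @ptws_eval_continuous R^o _ x (set_val k).
exact: (continuous_comp h1 h2).
Qed.

Definition dual_ball_eval (x : V) : Cp R K := MkCp (dual_ball_eval_continuous x).

Lemma dual_ball_eval_linear : linear dual_ball_eval.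
Proof.
move=> c x y; apply/val_inj/funext => k.
have [lk _] := set_valP k; exact: lk.
Qed.

HB.instance Definition _ :=
  GRing.isLinear.Build R V (Cp R K) _ dual_ball_eval dual_ball_eval_linear.

Lemma dual_ball_eval_inj : injective dual_ball_eval.
Proof.
move=> x y exy.
have sn : seminorm (fun z : V => `|z|).
  by split=> [u v|c u]; [exact: ler_normD|exact: normrZ].
have [phi [phixy phile]] := norming_functional (x - y) sn.
have Bphi : dual_ball phi by split=> //; exact: linearP.
pose k : K := exist _ (phi : {ptws V -> R^o}) (mem_set Bphi).
apply/eqP; rewrite -subr_eq0 -normr_eq0 -phixy linearB subr_eq0; apply/eqP.
by have := congr1 (fun h : Cp R K => h k) exy.
Qed.

End DualBallEvaluation.

(** Evaluation on the dual unit ball is weakly continuous. On its range it has a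
    weakly continuous left inverse because every continuous functional is a
    multiple [M] of an element [k] of the ball, so that its value at a point is
    [M] times the value at [k] of the image of that point. *)
Theorem normable_Eberlein_Grothendieck (R : realType) (E : tvsType R) :
  normable E -> linearly_Eberlein_Grothendieck (weak_space E).
Proof.
move=> [V [f [cf [g [fK gK cg]]]]].
pose K := set_type (@dual_ball R V).
have lg : linear g by exact: can2_linear fK gK.
pose G : {linear V -> E} := HB.pack g (GRing.isLinear.Build R V E _ g lg).
pose e : {linear weak_space E -> Cp R K} := @dual_ball_eval R V \o f.
have ce : continuous e.
  apply: continuous_into_Cp => k x.
  have [lk nk] := set_valP k.
  pose k' : {linear V -> R^o} := HB.pack (set_val k : V -> R^o)
    (GRing.isLinear.Build R V R^o _ (set_val k : V -> R^o) lk).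
  have ck : continuous (k' \o f : E -> R^o).
    move=> y; apply: continuous_comp; first exact: cf.
    apply/bounded_linear_continuous/linear_boundedP.
    exists 1; split=> // r r1 z; apply: le_trans (nk z) _.
    by rewrite ler_peMl// ltW.
  pose phi : dual E := exist (fun l : {linear E -> R^o} => continuous l)
    (k' \o f : {linear E -> R^o}) ck.
  exact: (@weak_functional_continuous R E phi x).
have ie : injective e by exact: inj_comp (@dual_ball_eval_inj R V) (can_inj fK).
have /choice[h hP] (u : Cp R K) : exists x : weak_space E,
    forall y, e y = u -> y = x.
  have [[x ex]|ne] := pselect (exists x, e x = u).
    by exists x => y; rewrite -ex => /ie.
  by exists 0 => y ey; case: ne; exists y.
have hK : cancel e h by move=> x; apply/esym/hP.
exists K; split; first exact: compact_set_type (@compact_dual_ball R V).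
  apply: (@injective_hausdorff K {ptws V -> R^o} set_val).
  - exact: initial_continuous.
  - exact: val_inj.
  - by apply: hausdorff_product => _; exact: norm_hausdorff.
exists e; split=> //; exists h; split=> //.
apply: continuous_into_weak => phi.
pose psi : {linear V -> R^o} := sval phi \o G.
have cpsi : {for 0, continuous psi}.
  exact: (continuous_comp (cg 0) (svalP phi (g 0))).
have /linear_boundedP/pinfty_ex_gt0[M M0 psiM] := continuous_linear_bounded 0 cpsi.
pose psi' : {linear V -> R^o} := M^-1 \*: psi.
have Bpsi : dual_ball psi'.
  split; first exact: linearP.
  move=> x; rewrite /= normrZ gtr0_norm ?invr_gt0// ler_pdivrMl//; exact: psiM.
pose k : K := exist _ (psi' : {ptws V -> R^o}) (mem_set Bpsi).
apply: (@subspace_eq_continuous _ _ _ (fun u : Cp R K => M *: (u k : R^o))).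
  move=> _ /set_mem[x _ <-]; rewrite -[from_subspace _ h (e x)]/(h (e x)) hK.
  change (M * (M^-1 * sval phi (g (f x))) = sval phi x).
  by rewrite fK mulrA divff ?gt_eqF// mul1r.
apply: continuous_subspaceT => u.
exact: (@cvgZl_tmp _ R^o _ _ _ M _ _ (@Cp_eval_continuous _ _ k u)).
Qed.

Theorem theorem3p9 (R : realType) (E : tvsType R) (hE : is_LF E) :
  linearly_Eberlein_Grothendieck (weak_space E) <-> normable E.
Proof.
split; first exact: LF_Eberlein_Grothendieck_normable.
exact: normable_Eberlein_Grothendieck.
Qed.
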